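(* Let $\mathbb{K}$ be a commutative ring and $V$ a free $\mathbb{K}$-module with a fixed basis $\mathcal{V}$. The set $\mathcal{O}\mathcal{S}(\mathcal{RT},\mathcal{V})=\{\mathcal{O}\mathtt{t}\mid\mathtt{t}\in\mathcal{S}(\mathcal{RT},\mathcal{V})\}$ forms a basis of the $\mathbb{K}$-module $\Gamma(RT,V)$.
   Context: An $n$-tree is a finite non-empty connected acyclic graph with a distinguished vertex (the root) and a bijection between its vertices and $\{1,\ldots,n\}$ (trees are not planar). $\mathcal{RT}(n)$ is the set of $n$-trees, with the symmetric group $\mathbb{S}_n$ acting by relabelling, and $RT(n)=\mathbb{K}[\mathcal{RT}(n)]$ is the free module on it. Put $S(RT,V)=\bigoplus_n(RT(n)\otimes V^{\otimes n})_{\mathbb{S}_n}$ (coinvariants) and $\Gamma(RT,V)=\bigoplus_n(RT(n)\otimes V^{\otimes n})^{\mathbb{S}_n}$ (invariants), for the diagonal action: $\sigma$ relabels vertex $i$ as $\sigma(i)$ and moves the $i$-th letter to position $\sigma(i)$. For $\tau\in\mathcal{RT}(n)$ and $x_i\in\mathcal{V}$, $\tau\langle x_1,\ldots,x_n\rangle$ denotes $\tau\otimes x_1\otimes\cdots\otimes x_n$ and $\tau(x_1,\ldots,x_n)$ its class in $S(RT,V)$; $\mathcal{S}(\mathcal{RT},\mathcal{V})$ is the set of all these classes $\tau(x_1,\ldots,x_n)$ (a basis of $S(RT,V)$). For $\mathtt{t}=\tau(x_1,\ldots,x_n)$, let $\mathrm{Stab}=\{\sigma\in\mathbb{S}_n:\sigma^*\tau\langle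 x_1,\ldots,x_n\rangle=\tau\langle x_1,\ldots,x_n\rangle\}$ and $\mathcal{O}\mathtt{t}=\sum_{\sigma\in\mathbb{S}_n/\mathrm{Stab}}\sigma^*\tau\langle x_1,\ldots,x_n\rangle$, which depends only on $\mathtt{t}$. *)

(* Defs.v *)
From HB Require Import structures.
From mathcomp Require Import all_boot all_algebra all_fingroup.
From mathcomp Require Import generic_quotient.
From mathcomp Require Import boolp classical_sets functions cardinality fsbigop.

Set Implicit Arguments.
Unset Strict Implicit.
Unset Printing Implicit Defensive.

Import GRing.Theory.
Local Open Scope ring_scope.
Local Open Scope quotient_scope.

Section Trees.
Local Open Scope set_scope.
Variable n : nat.

(* A simple graph on ['I_n] is given by its set of edges, an edge being a pair
   of distinct vertices. *)
Definition is_graph (E : {set {set 'I_n}}) := {in E, forall e : {set 'I_n}, #|e| = 2%N}.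

Definition adj (E : {set {set 'I_n}}) : rel 'I_n := fun x y => [set x; y] \in E.

Definition connected (E : {set {set 'I_n}}) := forall x y, connect (adj E) x y.

(* Closed walks of length 2 (back and forth along an edge) are [ucycle]s. *)
Definition acyclic (E : {set {set 'I_n}}) :=
  forall p : seq 'I_n, ucycle (adj E) p -> (size p <= 2)%N.

Definition is_tree (E : {set {set 'I_n}}) : bool :=
  `[< [/\ is_graph E, connected E & acyclic E] >].

(* The second component is the root; there is no [n]-tree for [n = 0]. *)
Definition rtree : finType := {t : {set {set 'I_n}} * 'I_n | is_tree t.1}.

Definition relabel_edges (s : 'S_n) (E : {set {set 'I_n}}) : {set {set 'I_n}} :=
  [set s @: (e : {set 'I_n}) | e in E].

Lemma relabel_is_tree (s : 'S_n) (t : rtree) : is_tree (relabel_edges s (val t).1).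
Proof.
case: t => -[E r] /= /asboolP[gE cE aE]; apply/asboolP.
have adjE x y : adj (relabel_edges s E) (s x) (s y) = adj E x y.
  rewrite /adj; have -> : [set s x; s y] = s @: [set x; y].
    by rewrite imsetU1 imset_set1.
  by rewrite mem_imset //; apply/imset_inj/perm_inj.
split.
- by move=> _ /imsetP[e eE ->]; rewrite card_imset; [apply: gE | apply: perm_inj].
- move=> x y; rewrite -(permKV s x) -(permKV s y).
  have /connectP[p pP ->] := cE ((s^-1)%g x) ((s^-1)%g y).
  apply/connectP; exists (map s p); last by rewrite last_map.
  by rewrite path_map (eq_path (e' := adj E)).
- move=> p; have -> : p = map s (map (s^-1)%g p).
    by rewrite -map_comp -[LHS]map_id; apply: eq_map => x /=; rewrite permKV.
  rewrite /ucycle cycle_map (map_inj_uniq (@perm_inj _ s)) => /andP[cp up].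
  rewrite size_map; apply: aE; rewrite /ucycle up andbT.
  by rewrite -(eq_cycle (e := relpre s (adj (relabel_edges s E)))).
Qed.

Definition relabel (s : 'S_n) (t : rtree) : rtree :=
  Sub (relabel_edges s (val t).1, s (val t).2) (relabel_is_tree s t).

End Trees.

Local Open Scope classical_set_scope.

Section Bases.
Variables (K : pzRingType) (M : lmodType K).

Definition is_submodule (N : set M) :=
  N 0 /\ forall (a : K) (u v : M), N u -> N v -> N (a *: u + v).

Definition submod_gen (A : set M) : set M := smallest is_submodule A.

Definition lin_indep (B : set M) :=
  forall c : M -> K, finite_set [set x | c x != 0] ->
  \sum_(x \in B) c x *: x = 0 -> forall x, B x -> c x = 0.

(* [B] is a basis of the submodule [N] of [M]. *)
Definition is_basis (N B : set M) := lin_indep B /\ submod_gen B = N.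

Lemma submod_gen_closed (A : set M) : is_submodule (submod_gen A).
Proof.
split=> [N [[]]//|a u v Au Av N NA]; case: (NA) => [[_ NS] _].
by apply: NS; [apply: Au | apply: Av].
Qed.

Lemma sub_submod_gen (A : set M) u : A u -> submod_gen A u.
Proof. exact: sub_smallest. Qed.

End Bases.

Section DirectSum.
Variables (K : pzRingType) (I : choiceType) (M : I -> lmodType K).

Definition finsupp (f : forall i, M i) : bool :=
  `[< finite_set [set i | f i != 0] >].

Record dsum := DSum { dsum_fun :> forall i, M i; dsumP : finsupp dsum_fun }.

HB.instance Definition _ := [isSub for dsum_fun].
HB.instance Definition _ := [Choice of dsum by <:].

Lemma dsum_eqP (u v : dsum) : (forall i, u i = v i) <-> u = v.
Proof. by split=> [uv|->//]; apply/val_inj/functional_extensionality_dep. Qed.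

Lemma finsupp0 : finsupp (fun i => 0 : M i).
Proof.
by apply/asboolP; apply: sub_finite_set (finite_set0 I) => i /=; rewrite eqxx.
Qed.

Lemma finsuppN (u : dsum) : finsupp (fun i => - u i).
Proof.
apply/asboolP; apply: sub_finite_set (asboolW (dsumP u)) => i /=.
by rewrite oppr_eq0.
Qed.

Lemma finsuppD (u v : dsum) : finsupp (fun i => u i + v i).
Proof.
apply/asboolP; have := asboolW (dsumP u); have := asboolW (dsumP v).
move=> fv fu; apply: sub_finite_set (_ : finite_set (_ `|` _)); last first.
  by rewrite finite_setU; split; [exact: fu | exact: fv].
move=> i /= uv0; case: (eqVneq (u i) 0) => [ui0|]; last by left.
by right; move: uv0; rewrite ui0 add0r.
Qed.

Lemma finsuppZ (a : K) (u : dsum) : finsupp (fun i => a *: u i).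
Proof.
apply/asboolP; apply: sub_finite_set (asboolW (dsumP u)) => i /=.
by apply: contra_neq => ->; rewrite scaler0.
Qed.

Definition dsum_zero := DSum finsupp0.
Definition dsum_opp u := DSum (finsuppN u).
Definition dsum_add u v := DSum (finsuppD u v).
Definition dsum_scale a u := DSum (finsuppZ a u).

Lemma dsum_addA : associative dsum_add.
Proof. by move=> u v w; apply/dsum_eqP => i /=; rewrite addrA. Qed.
Lemma dsum_addC : commutative dsum_add.
Proof. by move=> u v; apply/dsum_eqP => i /=; rewrite addrC. Qed.
Lemma dsum_add0 : left_id dsum_zero dsum_add.
Proof. by move=> u; apply/dsum_eqP => i /=; rewrite add0r. Qed.
Lemma dsum_addN : left_inverse dsum_zero dsum_opp dsum_add.
Proof. by move=> u; apply/dsum_eqP => i /=; rewrite addNr. Qed.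

HB.instance Definition _ :=
  GRing.isZmodule.Build dsum dsum_addA dsum_addC dsum_add0 dsum_addN.

Lemma dsum_scaleA a b u : dsum_scale a (dsum_scale b u) = dsum_scale (a * b) u.
Proof. by apply/dsum_eqP => i /=; rewrite scalerA. Qed.
Lemma dsum_scale1 : left_id 1 dsum_scale.
Proof. by move=> u; apply/dsum_eqP => i /=; rewrite scale1r. Qed.
Lemma dsum_scaleDr : right_distributive dsum_scale +%R.
Proof. by move=> a u v; apply/dsum_eqP => i /=; rewrite scalerDr. Qed.
Lemma dsum_scaleDl u : {morph dsum_scale^~ u : a b / a + b}.
Proof. by move=> a b; apply/dsum_eqP => i /=; rewrite scalerDl. Qed.

HB.instance Definition _ := GRing.Zmodule_isLmodule.Build K dsum
  dsum_scaleA dsum_scale1 dsum_scaleDr dsum_scaleDl.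

Lemma finsupp_in i (x : M i) : finsupp (dfwith (fun j => 0 : M j) x).
Proof.
apply/asboolP; apply: sub_finite_set (finite_set1 i) => j /=.
by case: dfwithP => [//|k ik]; rewrite eqxx.
Qed.

Definition dsum_in i (x : M i) : dsum := DSum (finsupp_in x).

End DirectSum.

Section FreeModule.
Variables (K : pzRingType) (X : choiceType).

Definition freemod : lmodType K := dsum (fun _ : X => K^o).

Definition free_in (x : X) : freemod := dsum_in (1 : K^o) (i := x).

Definition lin_ext (N : lmodType K) (f : X -> N) (u : freemod) : N :=
  \sum_(x \in [set: X]) (u x : K) *: f x.

Lemma lin_extE (N : lmodType K) (f : X -> N) (u : freemod) (s : seq X) :
  uniq s -> (forall x, u x != 0 -> x \in s) ->
  lin_ext f u = \sum_(x <- s) (u x : K) *: f x.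
Proof.
move=> us su; rewrite /lin_ext (fsbigE s) //.
  by apply: eq_bigl => x; rewrite in_setT.
move=> x _; apply: contraNeq; have [->|/su//] := eqVneq (u x) 0.
by rewrite scale0r eqxx.
Qed.

Lemma freemod_supp (u : freemod) : exists s : seq X, forall x, u x != 0 -> x \in s.
Proof.
have /finite_seqP[s us] := asboolW (dsumP u); exists s => x ux.
by have : [set x | u x != 0] x by []; rewrite us.
Qed.

Lemma lin_ext_is_linear (N : lmodType K) (f : X -> N) : linear (lin_ext f).
Proof.
move=> a u v; have [s us] := freemod_supp u; have [r vr] := freemod_supp v.
pose q := undup (s ++ r).
have uq x : u x != 0 -> x \in q by rewrite mem_undup mem_cat => /us ->.
have vq x : v x != 0 -> x \in q by rewrite mem_undup mem_cat orbC => /vr ->.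
rewrite !(@lin_extE _ _ _ q) ?undup_uniq //.
  rewrite scaler_sumr -big_split; apply: eq_bigr => x _ /=.
  by rewrite scalerDl scalerA.
move=> x; apply: contraNT => xq.
have /eqP u0 : u x == 0 by apply: contraNT xq; apply: uq.
have /eqP v0 : v x == 0 by apply: contraNT xq; apply: vq.
by rewrite /= u0 v0 scaler0 addr0.
Qed.

Lemma lin_ext_in (N : lmodType K) (f : X -> N) x : lin_ext f (free_in x) = f x.
Proof.
rewrite (@lin_extE _ _ _ [:: x]) // ?big_seq1 /=.
  by rewrite dfwith_in scale1r.
by move=> y; case: dfwithP => [_|z _]; rewrite ?inE ?eqxx.
Qed.

End FreeModule.

Section QuotientModule.
Variables (K : pzRingType) (M : lmodType K) (A : set M).

Definition quot_rel : rel M := fun u v => `[< submod_gen A (u - v) >].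

Lemma quot_rel_equiv : equiv_class_of quot_rel.
Proof.
have [A0 AS] := submod_gen_closed A.
have AN u : submod_gen A u -> submod_gen A (- u).
  by move=> Au; rewrite -[- u]addr0 -scaleN1r; apply: AS.
split=> [u|u v|v u w].
- by apply/asboolP; rewrite subrr.
- by rewrite /quot_rel; congr `[< _ >]; apply/propext; split=> /AN; rewrite opprB.
- move=> /asboolP vu /asboolP uw; apply/asboolP.
  by have := AS 1 _ _ vu uw; rewrite scale1r subrKA.
Qed.

Canonical quot_equiv := EquivRelPack quot_rel_equiv.

Definition quotmod := {eq_quot quot_equiv}.

HB.instance Definition _ := Choice.on quotmod.
HB.instance Definition _ : isEqQuotient _ quot_equiv quotmod :=
  EqQuotient.on quotmod.

Definition cls (u : M) : quotmod := \pi_quotmod u.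

Lemma clsP (u v : M) : cls u = cls v <-> submod_gen A (u - v).
Proof.
split=> [/eqmodP /asboolP//|uv]; apply/eqmodP; exact/asboolP.
Qed.

Lemma cls_repr (q : quotmod) : cls (repr q) = q.
Proof. exact: reprK. Qed.

Lemma cls_ind (P : quotmod -> Prop) : (forall u, P (cls u)) -> forall q, P q.
Proof. by move=> Pu q; rewrite -[q]cls_repr. Qed.

Definition quot_opp (q : quotmod) := cls (- repr q).
Definition quot_add (q r : quotmod) := cls (repr q + repr r).
Definition quot_scale (a : K) (q : quotmod) := cls (a *: repr q).

Lemma repr_cls (u : M) : submod_gen A (repr (cls u) - u).
Proof. by apply/clsP; rewrite cls_repr. Qed.

Lemma quot_oppE u : quot_opp (cls u) = cls (- u).
Proof.
have [A0 AS] := submod_gen_closed A; apply/clsP.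
by have := AS (-1) _ _ (repr_cls u) A0; rewrite addr0 scaleN1r opprD.
Qed.

Lemma quot_addE u v : quot_add (cls u) (cls v) = cls (u + v).
Proof.
have [A0 AS] := submod_gen_closed A; apply/clsP.
by have := AS 1 _ _ (repr_cls u) (repr_cls v); rewrite scale1r addrACA opprD.
Qed.

Lemma quot_scaleE a u : quot_scale a (cls u) = cls (a *: u).
Proof.
have [A0 AS] := submod_gen_closed A; apply/clsP.
by have := AS a _ _ (repr_cls u) A0; rewrite addr0 scalerBr.
Qed.

Lemma quot_addA : associative quot_add.
Proof.
by elim/cls_ind=> u; elim/cls_ind=> v; elim/cls_ind=> w; rewrite !quot_addE addrA.
Qed.
Lemma quot_addC : commutative quot_add.
Proof. by elim/cls_ind=> u; elim/cls_ind=> v; rewrite !quot_addE addrC. Qed.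
Lemma quot_add0 : left_id (cls 0) quot_add.
Proof. by elim/cls_ind=> u; rewrite quot_addE add0r. Qed.
Lemma quot_addN : left_inverse (cls 0) quot_opp quot_add.
Proof. by elim/cls_ind=> u; rewrite quot_oppE quot_addE addNr. Qed.

HB.instance Definition _ :=
  GRing.isZmodule.Build quotmod quot_addA quot_addC quot_add0 quot_addN.

Lemma quot_scaleA a b q : quot_scale a (quot_scale b q) = quot_scale (a * b) q.
Proof. by elim/cls_ind: q => u; rewrite !quot_scaleE scalerA. Qed.
Lemma quot_scale1 : left_id 1 quot_scale.
Proof. by elim/cls_ind=> u; rewrite quot_scaleE scale1r. Qed.
Lemma quot_scaleDr : right_distributive quot_scale +%R.
Proof.
move=> a; elim/cls_ind=> u; elim/cls_ind=> v.
by rewrite [cls u + _]quot_addE !quot_scaleE [RHS]quot_addE scalerDr.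
Qed.
Lemma quot_scaleDl q : {morph quot_scale^~ q : a b / a + b}.
Proof.
elim/cls_ind: q => u a b; rewrite !quot_scaleE [RHS]quot_addE.
by rewrite scalerDl.
Qed.

HB.instance Definition _ := GRing.Zmodule_isLmodule.Build K quotmod
  quot_scaleA quot_scale1 quot_scaleDr quot_scaleDl.

Lemma cls_is_linear : linear cls.
Proof. by move=> a u v; rewrite [LHS](esym (quot_addE _ _)) -quot_scaleE. Qed.

HB.instance Definition _ := GRing.isLinear.Build K M quotmod *:%R cls cls_is_linear.

(* Meaningful when [f] is linear and vanishes on [A]. *)
Definition quot_lift (N : Type) (f : M -> N) (q : quotmod) : N := f (repr q).

Section QuotLift.
Variables (N : lmodType K) (f : M -> N).
Hypotheses (fL : linear f) (fA : forall u, A u -> f u = 0).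

Lemma quot_liftE u : quot_lift f (cls u) = f u.
Proof.
have ker : submod_gen A (repr (cls u) - u) -> f (repr (cls u) - u) = 0.
  move=> /(_ [set w | f w = 0]); apply; split=> //=; split=> [|a v w /= fv fw].
    by have := fL (-1) 0 0; rewrite scaler0 addr0 scaleN1r addNr.
  by rewrite fL fv fw scaler0 addr0.
have /eqP := ker (repr_cls u); rewrite addrC -scaleN1r fL scaleN1r addrC.
by rewrite subr_eq0 => /eqP.
Qed.

Lemma quot_lift_is_linear : linear (quot_lift f).
Proof.
move=> a; elim/cls_ind=> u; elim/cls_ind=> v.
by rewrite -cls_is_linear !quot_liftE fL.
Qed.

End QuotLift.

End QuotientModule.

Section Tensor.
Variables (K : comPzRingType) (P Q : lmodType K).

Definition tens_rel : set (freemod K (P * Q)%type) :=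
  [set r | exists (a : K) (p p' : P) (q : Q),
     r = free_in K (a *: p + p', q) - (a *: free_in K (p, q) + free_in K (p', q))]
  `|` [set r | exists (a : K) (p : P) (q q' : Q),
     r = free_in K (p, a *: q + q') - (a *: free_in K (p, q) + free_in K (p, q'))].

Definition tens : lmodType K := quotmod tens_rel.

Definition tens_in (p : P) (q : Q) : tens := cls tens_rel (free_in K (p, q)).

(* Meaningful when [f] is bilinear. *)
Definition tens_lift (N : lmodType K) (f : P -> Q -> N) : tens -> N :=
  quot_lift (lin_ext (fun pq => f pq.1 pq.2)).

Section TensLift.
Variables (N : lmodType K) (f : P -> Q -> N).
Hypotheses (fl : forall q, linear (f^~ q)) (fr : forall p, linear (f p)).

Let f_rel r : tens_rel r -> lin_ext (fun pq => f pq.1 pq.2) r = 0.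
Proof.
have L := lin_ext_is_linear (fun pq => f pq.1 pq.2).
case=> [[a [p [p' [q ->]]]]|[a [p [q [q' ->]]]]];
  by rewrite addrC -scaleN1r L L !lin_ext_in /= (fl, fr) scaleN1r addNr.
Qed.

Lemma tens_liftE p q : tens_lift f (tens_in p q) = f p q.
Proof.
by rewrite /tens_lift quot_liftE ?lin_ext_in //; apply: lin_ext_is_linear.
Qed.

Lemma tens_lift_is_linear : linear (tens_lift f).
Proof. by apply: quot_lift_is_linear f_rel; apply: lin_ext_is_linear. Qed.

End TensLift.

Lemma tens_in_linearl q : linear (tens_in^~ q).
Proof.
move=> a p p'; rewrite /tens_in -linearP; apply/clsP; apply: sub_submod_gen.
by apply: or_introl; exists a, p, p', q.
Qed.

Lemma tens_in_linearr p : linear (tens_in p).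
Proof.
move=> a q q'; rewrite /tens_in -linearP; apply/clsP; apply: sub_submod_gen.
by apply: or_intror; exists a, p, q, q'.
Qed.

End Tensor.

Section TensorPower.
Variables (K : comPzRingType) (V : lmodType K) (n : nat).

Definition word := {ffun 'I_n -> V}.

Definition set_letter (x : word) (i : 'I_n) (v : V) : word :=
  [ffun j => if j == i then v else x j].

Definition tpow_rel : set (freemod K word) :=
  [set r | exists (x : word) (i : 'I_n) (a : K) (v w : V),
     r = free_in K (set_letter x i (a *: v + w))
         - (a *: free_in K (set_letter x i v) + free_in K (set_letter x i w))].

Definition tpow : lmodType K := quotmod tpow_rel.

Definition tpow_in (x : word) : tpow := cls tpow_rel (free_in K x).

(* Meaningful when [f] is multilinear. *)
Definition tpow_lift (N : lmodType K) (f : word -> N) : tpow -> N :=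
  quot_lift (lin_ext f).

Section TpowLift.
Variables (N : lmodType K) (f : word -> N).
Hypothesis fL : forall x i, linear (fun v => f (set_letter x i v)).

Let f_rel r : tpow_rel r -> lin_ext f r = 0.
Proof.
have L := lin_ext_is_linear f.
case=> [x [i [a [v [w ->]]]]].
by rewrite addrC -scaleN1r L L !lin_ext_in /= fL scaleN1r addNr.
Qed.

Lemma tpow_liftE x : tpow_lift f (tpow_in x) = f x.
Proof.
by rewrite /tpow_lift quot_liftE ?lin_ext_in //; apply: lin_ext_is_linear.
Qed.

Lemma tpow_lift_is_linear : linear (tpow_lift f).
Proof. by apply: quot_lift_is_linear f_rel; apply: lin_ext_is_linear. Qed.

End TpowLift.

Lemma tpow_in_multilinear x i : linear (fun v => tpow_in (set_letter x i v)).
Proof.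
move=> a v w; rewrite /tpow_in -linearP; apply/clsP; apply: sub_submod_gen.
by exists x, i, a, v, w.
Qed.

End TensorPower.

Section DecoratedTrees.
Variables (K : comPzRingType) (V : lmodType K).

Definition RT (n : nat) : lmodType K := freemod K (rtree n).

Definition RT_act n (s : 'S_n) : RT n -> RT n :=
  lin_ext (fun t => free_in K (relabel s t)).

(* The [i]-th letter of [x] is the [s i]-th letter of [word_act s x]. *)
Definition word_act n (s : 'S_n) (x : word V n) : word V n :=
  [ffun j => x ((s^-1)%g j)].

Definition tpow_act n (s : 'S_n) : tpow V n -> tpow V n :=
  tpow_lift (fun x => tpow_in (word_act s x)).

Definition RTV (n : nat) : lmodType K := tens (RT n) (tpow V n).

Definition act n (s : 'S_n) : RTV n -> RTV n :=
  tens_lift (fun t w => tens_in (RT_act s t) (tpow_act s w)).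

Definition deco n (t : rtree n) (x : word V n) : RTV n :=
  tens_in (free_in K t) (tpow_in x).

Lemma word_act_set_letter n (s : 'S_n) (x : word V n) i v :
  word_act s (set_letter x i v) = set_letter (word_act s x) (s i) v.
Proof.
by apply/ffunP=> j; rewrite !ffunE (canF_eq (permKV s)).
Qed.

Let tpow_act_multilinear n (s : 'S_n) (x : word V n) i :
  linear (fun v => tpow_in (word_act s (set_letter x i v))).
Proof. by move=> a v w; rewrite !word_act_set_letter tpow_in_multilinear. Qed.

Lemma tpow_act_in n (s : 'S_n) (x : word V n) :
  tpow_act s (tpow_in x) = tpow_in (word_act s x).
Proof. by rewrite /tpow_act tpow_liftE. Qed.

Lemma tpow_act_is_linear n (s : 'S_n) : linear (@tpow_act n s).
Proof. exact: tpow_lift_is_linear. Qed.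

Let act_linearl n (s : 'S_n) (w : tpow V n) :
  linear (fun t => tens_in (RT_act s t) (tpow_act s w)).
Proof. by move=> a t t'; rewrite /RT_act lin_ext_is_linear tens_in_linearl. Qed.

Let act_linearr n (s : 'S_n) (t : RT n) :
  linear (fun w => tens_in (RT_act s t) (tpow_act s w)).
Proof. by move=> a w w'; rewrite tpow_act_is_linear tens_in_linearr. Qed.

Lemma act_in n (s : 'S_n) t w :
  act s (tens_in t w : RTV n) = tens_in (RT_act s t) (tpow_act s w).
Proof. by rewrite /act tens_liftE. Qed.

Lemma act_is_linear n (s : 'S_n) : linear (@act n s).
Proof. exact: tens_lift_is_linear. Qed.

Lemma act_deco n (s : 'S_n) (t : rtree n) (x : word V n) :
  act s (deco t x) = deco (relabel s t) (word_act s x).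
Proof. by rewrite /deco act_in tpow_act_in /RT_act lin_ext_in. Qed.

Definition coinv_rel n : set (RTV n) :=
  [set r | exists (s : 'S_n) (u : RTV n), r = act s u - u].

Definition S_RT : lmodType K := dsum (fun n => quotmod (@coinv_rel n)).

(* The direct sum of the invariants, inside the direct sum of the [RTV n]. *)
Definition Gamma_RT : set (dsum RTV) :=
  [set u : dsum RTV | forall (n : nat) (s : 'S_n), act s (u n) = u n].

Definition S_class n (t : rtree n) (x : word V n) : S_RT :=
  dsum_in (M := fun n => quotmod (@coinv_rel n)) (cls (@coinv_rel n) (deco t x)).

Definition S_set (B : set V) : set S_RT :=
  [set c | exists (n : nat) (t : rtree n) (x : word V n),
     (forall i, B (x i)) /\ c = S_class t x].

Definition Stab n (u : RTV n) : {set 'S_n} := [set s | act s u == u]%SET.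

(* Since [(s * r) i = r (s i)] in ['S_n], [act] is a right action for this product,
   and the cosets [s Stab] of the usual composition are right cosets here. *)
Definition orbit_sum n (u : RTV n) : RTV n :=
  \sum_(C in rcosets (Stab u) [set: 'S_n]%SET) act (fingroup.repr C) u.

(* [OO B c] is computed on any way to write [c] as [t(x_1, ..., x_n)] with the
   [x_i] in [B]; the result does not depend on it. *)
Definition OO (B : set V) (c : S_RT) : dsum RTV :=
  xget 0 [set o | exists (n : nat) (t : rtree n) (x : word V n),
    [/\ forall i, B (x i), c = S_class t x & o = dsum_in (orbit_sum (deco t x))]].

Definition OS (B : set V) : set (dsum RTV) := OO B @` S_set B.

End DecoratedTrees.

Arguments Gamma_RT {K} V.

(* Main.v *)
Require Import Defs.
From HB Require Import structures.
From mathcomp Require Import all_boot all_algebra all_fingroup.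
From mathcomp Require Import boolp classical_sets functions cardinality fsbigop.

(** Pure tensors of an [n]-tree and a word in the basis [B] form a basis of each
    [RTV V n], and the symmetric group permutes this basis.  For a group acting
    on a module by permuting a basis, the invariants are the vectors whose
    coordinates are constant along orbits, so the sums over the orbits form a
    basis of the invariants.  No averaging is involved, which is why the
    statement holds over every commutative ring.

    That the pure tensors [deco_of p] are a basis is used in the form of a dual
    system: they generate ([deco_basis_gen]), and there are linear forms
    [deco_coord p] with [deco_coord p (deco_of q) = (p == q)%:R]
    ([deco_coordE]), built from coordinates on [V] ([coord_exists]) through the
    universal properties of the tensor constructions.  The invariants are then
    generated by orbit sums ([invariant_gen]): subtracting a multiple of the
    orbit sum of [p] from an invariant kills its coordinates on the whole orbit
    of [p] and leaves the others alone, so that the finite support shrinks.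
    Orbit sums are independent ([OS_lin_indep]), as the form [deco_coord p]
    tells the orbit sum of [p] from all the others.

    It remains to see that [OO] is well defined ([S_class_orbit_sum]): two
    decorated trees with the same class among the coinvariants lie in the same
    orbit.  Indeed the sum of the coordinates over an orbit is an invariant
    linear form, hence vanishes on the relations defining the coinvariants,
    and it separates this orbit from the others when [1 != 0]
    ([orbit_functional], [coinv_orb]).  Over the zero ring all modules vanish
    and there is nothing to prove. *)

Set Implicit Arguments.
Unset Strict Implicit.
Unset Printing Implicit Defensive.

Import GRing.Theory.
Local Open Scope ring_scope.
Local Open Scope classical_set_scope.

(** * Submodules and generators *)

Section Submodules.
Variables (K : pzRingType) (M N : lmodType K).

Lemma submod_gen_min (A S : set M) :
  is_submodule S -> A `<=` S -> submod_gen A `<=` S.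
Proof. by move=> Ssub AS u; apply. Qed.

(** Linearity stays a hypothesis on a bare function here and below: most linear
    maps at hand, such as lifts and actions, are not bundled. *)
Lemma lin0 (f : M -> N) : linear f -> f 0 = 0.
Proof. by move=> fL; have := fL (-1) 0 0; rewrite scaler0 addr0 scaleN1r addNr. Qed.

Lemma linZ (f : M -> N) a u : linear f -> f (a *: u) = a *: f u.
Proof. by move=> fL; have := fL a u 0; rewrite !addr0 lin0 // addr0. Qed.

Lemma linB (f : M -> N) u v : linear f -> f (u - v) = f u - f v.
Proof. by move=> fL; rewrite addrC -scaleN1r fL scaleN1r addrC. Qed.

Lemma lin_sum (f : M -> N) I (r : seq I) (P : pred I) (F : I -> M) :
  linear f -> f (\sum_(i <- r | P i) F i) = \sum_(i <- r | P i) f (F i).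
Proof.
move=> fL; apply: (big_morph f) => [u v|]; last exact: lin0.
by have := fL 1 u v; rewrite !scale1r.
Qed.

Lemma submodule_preim (f : M -> N) (S : set N) :
  linear f -> is_submodule S -> is_submodule (f @^-1` S).
Proof.
move=> fL [S0 SS]; split=> [|a u v /= fu fv] /=; first by rewrite lin0.
by rewrite fL; apply: SS.
Qed.

Lemma submodule_eq (f g : M -> N) :
  linear f -> linear g -> is_submodule [set u | f u = g u].
Proof.
move=> fL gL; split=> [|a u v /= fu fv] /=; first by rewrite !lin0.
by rewrite fL gL fu fv.
Qed.

End Submodules.

Lemma submodule_sum (K : pzRingType) (M : lmodType K) (S : set M) I (r : seq I)
    (P : pred I) (F : I -> M) :
  is_submodule S -> (forall i, P i -> S (F i)) -> S (\sum_(i <- r | P i) F i).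
Proof.
move=> [S0 SS] SF; elim/big_rec: _ => // i u Pi Su.
by rewrite -[F i]scale1r; apply: SS => //; apply: SF.
Qed.

(** This lemma and its analogues below are induction principles: to show that
    a submodule is everything it suffices to look at generators. *)
Lemma freemod_gen (K : pzRingType) (X : choiceType) (S : set (freemod K X)) :
  is_submodule S -> (forall x, S (free_in K x)) -> forall u, S u.
Proof.
move=> Ssub Sin u; have [s0 us0] := freemod_supp u.
pose s := undup s0; have us x : u x != 0 -> x \in s by rewrite mem_undup; apply: us0.
suff -> : u = \sum_(x <- s) (u x : K) *: free_in K x.
  apply: submodule_sum => // x _; rewrite -[_ *: _]addr0.
  by case: (Ssub) => S0 SS; apply: SS.
apply/dsum_eqP => y.
pose ev (v : freemod K X) : K^o := v y.
have evL : linear ev by [].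
rewrite -[RHS]/(ev _) lin_sum //.
have [ys|yNs] := boolP (y \in s).
  rewrite (bigD1_seq y) ?undup_uniq //= big1 ?addr0 => [|x xy].
    by rewrite /ev /= dfwith_in [RHS]mulr1.
  by rewrite /ev /= dfwith_out // scaler0.
rewrite big_seq big1 => [|x xs]; first by apply/eqP; apply: contraNT yNs; apply: us.
rewrite /ev /= dfwith_out ?scaler0 //.
by apply: contraNneq yNs => <-.
Qed.

Lemma tpow_gen (K : comPzRingType) (V : lmodType K) n (S : set (tpow V n)) :
  is_submodule S -> (forall x, S (tpow_in x)) -> forall w, S w.
Proof.
move=> Ssub Sin; elim/cls_ind; apply: freemod_gen => //.
exact: submodule_preim (@cls_is_linear _ _ _) Ssub.
Qed.

Lemma tens_gen (K : comPzRingType) (P Q : lmodType K) (S : set (tens P Q)) :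
  is_submodule S -> (forall p q, S (tens_in p q)) -> forall w, S w.
Proof.
move=> Ssub Sin; elim/cls_ind; apply: freemod_gen => [|[p q]]; last exact: Sin.
exact: submodule_preim (@cls_is_linear _ _ _) Ssub.
Qed.

(** Here the words are arbitrary, with letters outside any given basis; the
    refinement to basis letters is [deco_basis_gen]. *)
Lemma RTV_gen (K : comPzRingType) (V : lmodType K) n (S : set (RTV V n)) :
  is_submodule S -> (forall t x, S (deco t x)) -> forall w, S w.
Proof.
move=> Ssub Sin; apply: tens_gen => // r w; move: r.
have subl := submodule_preim (tens_in_linearl w) Ssub.
apply: (freemod_gen subl) => t /=; move: w {subl}.
have subr := submodule_preim (tens_in_linearr (free_in K t)) Ssub.
by apply: (tpow_gen subr) => x; apply: Sin.
Qed.

Lemma dsum_in_same (K : pzRingType) (I : choiceType) (M : I -> lmodType K) i (x : M i) :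
  dsum_in x i = x.
Proof. by rewrite /= dfwith_in. Qed.

Lemma dsum_in_other (K : pzRingType) (I : choiceType) (M : I -> lmodType K) i j
    (x : M i) :
  i != j -> dsum_in x j = 0.
Proof. by move=> ij; rewrite /= dfwith_out. Qed.

Lemma dsum_in_linear (K : pzRingType) (I : choiceType) (M : I -> lmodType K) i :
  linear (@dsum_in K I M i).
Proof.
move=> a x y; apply/dsum_eqP => j /=; have [<-|ij] := eqVneq i j.
  by rewrite !dfwith_in.
by rewrite !dfwith_out // scaler0 addr0.
Qed.

Lemma dsum_ev_linear (K : pzRingType) (I : choiceType) (M : I -> lmodType K) i :
  linear (fun u : dsum M => u i).
Proof. by []. Qed.

Lemma dsum_gen (K : pzRingType) (I : choiceType) (M : I -> lmodType K)
    (S : set (dsum M)) (u : dsum M) :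
  is_submodule S -> (forall i, S (dsum_in (u i))) -> S u.
Proof.
move=> Ssub Sin; have /finite_seqP[s0 us0] := asboolW (dsumP u).
pose s := undup s0; have us i : u i != 0 -> i \in s.
  by move=> ui; rewrite mem_undup; have : [set i | u i != 0] i by []; rewrite us0.
suff -> : u = \sum_(i <- s) dsum_in (u i) by apply: submodule_sum.
apply/dsum_eqP => j; rewrite (lin_sum _ _ _ (@dsum_ev_linear _ _ _ j)).
have [js|jNs] := boolP (j \in s).
  rewrite (bigD1_seq j) ?undup_uniq //= dfwith_in big1 ?addr0 // => i ij.
  by rewrite dfwith_out.
rewrite big_seq big1 => [|i is_]; first by apply/eqP; apply: contraNT jNs; apply: us.
by rewrite /= dfwith_out //; apply: contraNneq jNs => <-.
Qed.

(** * Coordinates of a vector *)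

Section VectorCoordinates.
Variables (K : comPzRingType) (V : lmodType K) (B : set V).
Hypothesis basisB : is_basis [set: V] B.

Lemma basis_expansion v :
  exists u : freemod K V, (forall b, u b != 0 -> B b) /\ lin_ext id u = v.
Proof.
have : submod_gen B v by rewrite (proj2 basisB).
pose S := [set v | exists u : freemod K V,
  (forall b, u b != 0 -> B b) /\ lin_ext id u = v].
suff: submod_gen B `<=` S by apply.
apply: submod_gen_min => {v}[|b Bb /=].
  split=> [|a v v' [u [uB uv]] [u' [u'B uv']]].
    by exists 0; split=> [b|]; [rewrite eqxx | exact/lin0/lin_ext_is_linear].
  exists (a *: u + u'); split=> [b /=|]; last by rewrite lin_ext_is_linear uv uv'.
  have [-> |/uB//] := eqVneq (u b) 0.
  by rewrite scaler0 add0r => /u'B.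
exists (free_in K b); split; last exact: lin_ext_in.
by move=> c /=; case: dfwithP => [//|c' _]; rewrite eqxx.
Qed.

Lemma basis_expansion0 (u : freemod K V) :
  (forall b, u b != 0 -> B b) -> lin_ext id u = 0 -> u = 0.
Proof.
move=> uB u0; apply/dsum_eqP => b.
have [->//|/[dup] ub /uB Bb] := eqVneq (u b) 0.
apply: (proj1 basisB (fun b => u b)) => //; first exact: asboolW (dsumP u).
rewrite -[RHS]u0; apply: fsbig_widen => // c [_ Bc] /=.
by have [->|/uB//] := eqVneq (u c) 0; rewrite scale0r.
Qed.

(** Expansions on the basis exist and are unique; picking one for each vector
    therefore gives coordinates that are linear. *)
Lemma coord_exists : exists coord : V -> V -> K^o,
  (forall b, linear (coord b)) /\
  (forall b b', B b -> B b' -> coord b b' = (b == b')%:R).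
Proof.
have [e eP] := choice basis_expansion.
have eB v b : e v b != 0 -> B b by apply: (proj1 (eP v)).
have eE v : lin_ext id (e v) = v by apply: (proj2 (eP v)).
have supB (a : K) (u v : freemod K V) :
    (forall b, u b != 0 -> B b) -> (forall b, v b != 0 -> B b) ->
    forall b, (a *: u + v) b != 0 -> B b.
  move=> uB vB b /=; have [-> |/uB//] := eqVneq (u b) 0.
  by rewrite scaler0 add0r => /vB.
have eU v (u : freemod K V) : (forall b, u b != 0 -> B b) -> lin_ext id u = v -> e v = u.
  move=> uB uv; apply/eqP; rewrite -subr_eq0; apply/eqP; apply: basis_expansion0.
    by rewrite addrC -scaleN1r; apply: supB => //; apply: eB.
  by rewrite linB ?eE ?uv ?subrr //; apply: lin_ext_is_linear.
exists (fun b v => e v b); split=> [b a v w|b b' Bb Bb'].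
  suff -> : e (a *: v + w) = a *: e v + e w by [].
  by apply: eU; [apply: supB; apply: eB | rewrite lin_ext_is_linear !eE].
rewrite (eU b' (free_in K b')) ?lin_ext_in // => [|c /=].
  have [<-|bb'] := eqVneq b b'; first by rewrite /= dfwith_in.
  by rewrite /= dfwith_out // eq_sym.
by case: dfwithP => [//|c' _]; rewrite eqxx.
Qed.

End VectorCoordinates.

(** * Families with a dual family of coordinates *)

(** The hypotheses say that the [e p], for [p] satisfying [good], form a basis
    with coordinate forms [c p].  Generation is phrased as an induction
    principle.  The good indices sit in a larger type because having all letters
    in [B] is a proposition about words. *)
Section DualSystem.
Variables (K : pzRingType) (M : lmodType K) (X : eqType) (good : X -> Prop).
Variables (e : X -> M) (c : X -> M -> K^o).
Hypothesis cL : forall p, linear (c p).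
Hypothesis cE : forall p q, good p -> good q -> c p (e q) = (p == q)%:R.
Hypothesis e_gen : forall S : set M,
  is_submodule S -> (forall p, good p -> S (e p)) -> forall u, S u.

Lemma dual_expansion u : exists s : seq X, [/\ uniq s,
    forall p, p \in s -> good p &
    u = \sum_(p <- s) (c p u : K) *: e p].
Proof.
(* The vectors expanded over one given list are not closed under sums, but those
   expanded over every large enough list are. *)
suff [s0 [Bs0 s0u]] : exists s0 : seq X, (forall p, p \in s0 -> good p) /\
    forall s, uniq s -> (forall p, p \in s -> good p) -> {subset s0 <= s} ->
    u = \sum_(p <- s) (c p u : K) *: e p.
  have Bs p : p \in undup s0 -> good p by rewrite mem_undup; apply: Bs0.
  exists (undup s0); split=> //; first exact: undup_uniq.
  by apply: s0u => // [|p]; rewrite ?undup_uniq ?mem_undup.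
move: u; apply: e_gen => [|q Bq].
  split=> [|a u v [s1 [Bs1 s1u]] [s2 [Bs2 s2v]]].
    exists [::]; split=> // s _ _ _; rewrite big1 // => p _.
    by rewrite lin0 ?scale0r //; apply: cL.
  exists (s1 ++ s2); split=> [p|s us Bs sub].
    by rewrite mem_cat => /orP[/Bs1|/Bs2].
  transitivity (a *: (\sum_(p <- s) (c p u : K) *: e p)
      + \sum_(p <- s) (c p v : K) *: e p).
    congr (a *: _ + _).
      by apply: s1u => // p ps; apply: sub; rewrite mem_cat ps.
    by apply: s2v => // p ps; apply: sub; rewrite mem_cat ps orbT.
  rewrite scaler_sumr -big_split; apply: eq_bigr => p _ /=.
  by rewrite cL scalerDl scalerA.
exists [:: q]; split=> [p /[!inE]/eqP->//|s us Bs /(_ q (mem_head _ _)) qs].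
rewrite (bigD1_seq q) //= cE // eqxx scale1r big_seq_cond big1 ?addr0 //.
by move=> p /andP[/Bs Bp pq]; rewrite cE // (negPf pq) scale0r.
Qed.

Lemma dual_coord_sum (s : seq X) (a : X -> K) p :
  uniq s -> (forall q, q \in s -> good q) -> good p ->
  c p (\sum_(q <- s) a q *: e q) = if p \in s then a p else 0.
Proof.
move=> us Bs Bp; rewrite lin_sum; last exact: cL.
have E q : q \in s -> c p (a q *: e q) = a q * (p == q)%:R.
  by move=> /Bs Bq; rewrite linZ ?cE //; apply: cL.
case: ifP => [ps|pNs].
  rewrite (bigD1_seq p) //= E // eqxx mulr1 big_seq_cond big1 ?addr0 //.
  by move=> q /andP[qs qp]; rewrite E // eq_sym (negPf qp) mulr0.
rewrite big_seq big1 // => q qs; rewrite E //.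
by case: eqP qs pNs => [->->|]; rewrite ?mulr0.
Qed.

Lemma dual_coord_supp u :
  exists s : seq X, forall p, good p -> c p u != 0 -> p \in s.
Proof.
have [s [us Bs uE]] := dual_expansion u; exists s => p Bp.
by rewrite uE dual_coord_sum //; case: ifP => //; rewrite eqxx.
Qed.

Lemma dual_coord_inj u : (forall p, good p -> c p u = 0) -> u = 0.
Proof.
have [s [_ Bs {2}->]] := dual_expansion u => u0.
by rewrite big_seq big1 // => p /Bs/u0->; rewrite scale0r.
Qed.

End DualSystem.

(** Applied to a vanishing combination, the form attached to [u] returns the
    coefficient of [u]. *)
Lemma lin_indep_dual (K : pzRingType) (M : lmodType K) (A : set M) :
  (forall u, A u -> exists phi : M -> K^o,
    linear phi /\ forall v, A v -> phi v = (v == u)%:R) ->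
  lin_indep A.
Proof.
move=> dual a fin_a a0 u Au; have [phi [phiL phiE]] := dual u Au.
have /finite_seqP[s0 s0E] := fin_a.
have s0P v : (v \in s0) = (a v != 0).
  have E : [set x | a x != 0] v = [set` s0] v by rewrite s0E.
  by apply/idP/idP; [rewrite -[is_true _]E | rewrite -[is_true (v \in s0)]E].
pose s := [seq v <- undup s0 | `[< A v >]].
have us : uniq s by rewrite filter_uniq ?undup_uniq.
have sP v : (v \in s) = `[< A v >] && (a v != 0).
  by rewrite mem_filter mem_undup s0P.
have [-> //|au] := eqVneq (a u) 0.
have uins : u \in s by rewrite sP au andbT; apply/asboolP.
have E : \sum_(v \in A) a v *: v = \sum_(v <- s) a v *: v.
  rewrite (@fsbigE _ _ _ _ _ s) //.
  - rewrite big_seq_cond [RHS]big_seq_cond; apply: eq_bigl => v.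
    by rewrite andbT sP; case: asboolP => // Av; rewrite mem_set ?andbT.
  - by move=> v /=; rewrite sP => /andP[/asboolP].
  - move=> v Av; rewrite sP; case: asboolP => //= _; rewrite negbK => /eqP->.
    by rewrite scale0r.
have := congr1 phi a0; rewrite E (lin_sum _ _ _ phiL) (lin0 phiL) => <-.
rewrite (bigD1_seq u) //= big_seq_cond big1 => [|v /andP[]].
  by rewrite linZ // phiE // eqxx addr0 [RHS]mulr1.
rewrite sP => /andP[/asboolP Av _] /negPf vu.
by rewrite linZ // phiE // vu [LHS]mulr0.
Qed.

(** * Coordinates of a decorated tree *)

Section Decorated.
Variables (K : comPzRingType) (V : lmodType K) (n : nat).

(** The decorated trees before any linear structure is put on them, on which
    ['S_n] acts by plain permutations. *)
Definition dtree := (rtree n * word V n)%type.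

Definition deco_of (p : dtree) : RTV V n := deco p.1 p.2.

Definition dtree_act (s : 'S_n) (p : dtree) : dtree :=
  (relabel s p.1, word_act s p.2).

Lemma act_deco_of s p : Defs.act s (deco_of p) = deco_of (dtree_act s p).
Proof. exact: act_deco. Qed.

(** The order of the factors is reversed because a product of permutations
    applies its left factor first. *)
Lemma dtree_actM s r p : dtree_act (s * r)%g p = dtree_act r (dtree_act s p).
Proof.
case: p => [[[E v] Ev] x]; congr (_, _); last first.
  by apply/ffunP => j; rewrite !ffunE invMg permM.
apply: val_inj => /=; congr (_, _); last by rewrite permM.
rewrite /relabel_edges -imset_comp; apply: eq_imset => e /=.
by rewrite -imset_comp; apply: eq_imset => i /=; rewrite permM.
Qed.

Lemma dtree_act1 p : dtree_act 1 p = p.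
Proof.
case: p => [[[E v] Ev] x]; congr (_, _); last first.
  by apply/ffunP => j; rewrite !ffunE invg1 perm1.
apply: val_inj => /=; congr (_, _); last by rewrite perm1.
rewrite /relabel_edges -[RHS]imset_id; apply: eq_imset => e.
by rewrite -[RHS]imset_id; apply: eq_imset => i; rewrite perm1.
Qed.

Lemma dtree_actK s : cancel (dtree_act s) (dtree_act s^-1).
Proof. by move=> p; rewrite -dtree_actM mulgV dtree_act1. Qed.

Lemma dtree_actKV s : cancel (dtree_act s^-1) (dtree_act s).
Proof. by move=> p; rewrite -dtree_actM mulVg dtree_act1. Qed.

(** A duplicate-free list rather than a finite set: letters live in an arbitrary
    module, so that decorated trees do not form a finite type. *)
Definition orb (p : dtree) : seq dtree := undup (codom (dtree_act^~ p)).

Lemma orbP p q : reflect (exists s, q = dtree_act s p) (q \in orb p).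
Proof.
rewrite mem_undup; apply: (iffP codomP) => -[s ->]; by exists s.
Qed.

Lemma orb_refl p : p \in orb p.
Proof. by apply/orbP; exists 1%g; rewrite dtree_act1. Qed.

Lemma orb_eq p q : q \in orb p -> perm_eq (orb q) (orb p).
Proof.
move=> /orbP[s ->]; apply: uniq_perm; rewrite ?undup_uniq // => r.
apply/orbP/orbP => -[g ->]; first by exists (s * g)%g; rewrite dtree_actM.
by exists (s^-1 * g)%g; rewrite dtree_actM dtree_actK.
Qed.

Lemma orb_act s p : perm_eq [seq dtree_act s q | q <- orb p] (orb p).
Proof.
apply: uniq_perm; rewrite ?undup_uniq //.
  by rewrite map_inj_uniq ?undup_uniq //; apply: can_inj (dtree_actK s).
move=> r; apply/mapP/orbP => [[q /orbP[g ->] ->]|[g ->]].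
  by exists (g * s)%g; rewrite dtree_actM.
exists (dtree_act (g * s^-1) p); last by rewrite dtree_actM dtree_actKV.
by apply/orbP; exists (g * s^-1)%g.
Qed.

Variables (B : set V) (coord : V -> V -> K^o).
Hypothesis genB : submod_gen B = [set: V].
Hypothesis coordL : forall b, linear (coord b).
Hypothesis coordB : forall b b', B b -> B b' -> coord b b' = (b == b')%:R.

Definition in_basis (p : dtree) := forall i, B (p.2 i).

Lemma in_basis_act s p : in_basis p -> in_basis (dtree_act s p).
Proof. by move=> Bp i; rewrite ffunE; apply: Bp. Qed.

Lemma in_basis_orb p q : in_basis p -> q \in orb p -> in_basis q.
Proof. by move=> Bp /orbP[s ->]; apply: in_basis_act. Qed.

(** The product of the coordinates of the letters is multilinear, hence defined
    on the tensor power. *)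
Definition word_coord (y : word V n) : tpow V n -> K^o :=
  tpow_lift (fun x => \prod_i coord (y i) (x i) : K^o).

Lemma prod_coord_linear (y x : word V n) i :
  linear (fun v => \prod_j coord (y j) (set_letter x i v j) : K^o).
Proof.
move=> a v w; have H u : \prod_j coord (y j) (set_letter x i u j)
    = coord (y i) u * \prod_(j | j != i) coord (y j) (x j).
  rewrite (bigD1 i) //= ffunE eqxx; congr (_ * _).
  by apply: eq_bigr => j /negPf ji; rewrite ffunE ji.
by rewrite !H coordL [LHS]mulrDl -[a *: _]/(a * _) -mulrA.
Qed.

Lemma word_coord_linear y : linear (word_coord y).
Proof. by apply: tpow_lift_is_linear => x i; apply: prod_coord_linear. Qed.

Lemma word_coordE y x : word_coord y (tpow_in x) = \prod_i coord (y i) (x i).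
Proof. by rewrite /word_coord tpow_liftE // => z i; apply: prod_coord_linear. Qed.

Definition deco_coord (p : dtree) : RTV V n -> K^o :=
  tens_lift (fun (r : RT K n) w => (r p.1 : K^o) * word_coord p.2 w).

Let coord_l p w : linear (fun r : RT K n => (r p.1 : K^o) * word_coord p.2 w).
Proof. by move=> a r r' /=; rewrite [LHS]mulrDl -[a *: _]/(a * _) -mulrA. Qed.

Let coord_r p (r : RT K n) : linear (fun w => (r p.1 : K^o) * word_coord p.2 w).
Proof.
by move=> a w w'; rewrite word_coord_linear [LHS]mulrDr -[a *: _]/(a * _) mulrCA.
Qed.

Lemma deco_coord_linear p : linear (deco_coord p).
Proof. exact: tens_lift_is_linear (coord_l p) (coord_r p). Qed.

Lemma deco_coordE p q :
  in_basis p -> in_basis q -> deco_coord p (deco_of q) = (p == q)%:R.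
Proof.
case: p q => [t y] [t' x] By Bx; rewrite /deco_coord /deco_of /deco.
rewrite (tens_liftE (coord_l (t, y)) (coord_r (t, y))) word_coordE /=.
rewrite xpair_eqE; have [<-|tt'] := eqVneq t t'; last first.
  by rewrite dfwith_out ?mul0r // eq_sym.
rewrite dfwith_in mul1r; have [<-|yx] := eqVneq y x.
  by rewrite big1 // => i _; rewrite coordB ?eqxx.
have /existsP[i yxi] : [exists i, y i != x i].
  apply: contraT; rewrite negb_exists => /forallP E.
  by case/eqP: yx; apply/ffunP => i; apply/eqP; have := E i; rewrite negbK.
by rewrite (bigD1 i) //= coordB // (negPf yxi) mul0r.
Qed.

(** By induction on the number of letters outside [B]: with the other letters
    fixed, [deco t x] depends linearly on such a letter, and [B] generates
    [V]. *)
Lemma deco_basis_gen (S : set (RTV V n)) :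
  is_submodule S -> (forall p, in_basis p -> S (deco_of p)) -> forall u, S u.
Proof.
move=> Ssub SB; apply: RTV_gen => // t x.
have letter (k : nat) : forall x : word V n, (#|[set i | `[< ~ B (x i) >]]%SET| <= k)%N ->
    S (deco t x).
  elim: k => [|k IH] {}x xk.
    apply: (SB (t, x)) => i; apply: contrapT => nB.
    by move: xk; rewrite leqn0 cards_eq0 => /eqP/setP/(_ i); rewrite !inE => /asboolP.
  have [/existsP[i /asboolP nB]|/existsPn xB] :=
      boolP [exists i, `[< ~ B (x i) >]]; last first.
    by apply: (SB (t, x)) => i; apply: contrapT => nB; case/asboolP: (xB i).
  have xE : x = set_letter x i (x i).
    by apply/ffunP => j; rewrite ffunE; case: eqP => [->|].
  pose f v : RTV V n := tens_in (free_in K t) (tpow_in (set_letter x i v)).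
  have fL : linear f.
    by move=> a v w; rewrite /f tpow_in_multilinear tens_in_linearr.
  rewrite xE -[deco _ _]/(f (x i)).
  suff : submod_gen B `<=` f @^-1` S by rewrite genB; apply.
  apply: submod_gen_min => [|b Bb]; first exact: submodule_preim.
  apply: IH; rewrite -ltnS; apply: leq_trans xk; apply: proper_card.
  apply/properP; split.
    by apply/fintype.subsetP => j; rewrite !inE !ffunE; case: eqP.
  by exists i; rewrite !inE //= ffunE eqxx; apply/asboolP; apply.
exact: letter (leqnn _).
Qed.

Lemma deco_coord_sum (s : seq dtree) (a : dtree -> K) p :
  uniq s -> (forall q, q \in s -> in_basis q) -> in_basis p ->
  deco_coord p (\sum_(q <- s) a q *: deco_of q) = if p \in s then a p else 0.
Proof. exact: dual_coord_sum deco_coord_linear deco_coordE _ _ _. Qed.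

Lemma deco_coord_supp u :
  exists s : seq dtree, forall p, in_basis p -> deco_coord p u != 0 -> p \in s.
Proof. exact: dual_coord_supp deco_coord_linear deco_coordE deco_basis_gen u. Qed.

Lemma deco_coord_inj u : (forall p, in_basis p -> deco_coord p u = 0) -> u = 0.
Proof. exact: dual_coord_inj deco_coord_linear deco_coordE deco_basis_gen u. Qed.

(** Both sides are linear in [u], and on basis vectors both test whether [p] is
    the image of the given decorated tree under [s]. *)
Lemma deco_coord_act s p u : in_basis p ->
  deco_coord p (Defs.act s u) = deco_coord (dtree_act s^-1 p) u.
Proof.
move=> Bp; move: u; apply: deco_basis_gen => [|q Bq].
  apply: submodule_eq => [a u v|]; last exact: deco_coord_linear.
  by rewrite act_is_linear deco_coord_linear.
rewrite /= act_deco_of !deco_coordE //; try exact: in_basis_act.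
by rewrite -[in RHS](can_eq (dtree_actK s)) dtree_actKV.
Qed.

(** * Orbit sums *)

Hypothesis K1 : 1 != 0 :> K.

Lemma deco_of_inj p q : in_basis p -> in_basis q -> deco_of p = deco_of q -> p = q.
Proof.
move=> Bp Bq pq; apply/eqP/contraT => /negPf pNq.
have := deco_coordE Bp Bq; rewrite -pq deco_coordE // eqxx pNq => /eqP.
by rewrite (negPf K1).
Qed.

(** The cosets of the stabilizer are in bijection with the orbit, through
    [C |-> repr C . p].  The stabilizer of the tensor [deco_of p] is that of [p]
    itself because distinct basis indices give distinct tensors, which needs
    [1 != 0]. *)
Lemma orbit_sumE p : in_basis p ->
  orbit_sum (deco_of p) = \sum_(q <- orb p) deco_of q.
Proof.
move=> Bp; pose St := Stab (deco_of p).
have StE s : (s \in St) = (dtree_act s p == p).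
  rewrite inE act_deco_of; apply/eqP/eqP => [|->//].
  by apply: deco_of_inj => //; apply: in_basis_act.
have gSt : group_set St.
  apply/group_setP; split=> [|s r]; first by rewrite StE dtree_act1.
  by rewrite !StE dtree_actM => /eqP->.
have [G GE] : exists G : {group 'S_n}, St = G by exists (Group gSt).
rewrite /orbit_sum -/St GE; rewrite GE in StE.
pose r C := dtree_act (fingroup.repr C) p.
have r_orb : perm_eq [seq r C | C <- enum (rcosets G [set: 'S_n]%SET)] (orb p).
  apply: uniq_perm; rewrite ?undup_uniq //.
    rewrite map_inj_in_uniq ?enum_uniq // => C D.
    rewrite !mem_enum => /rcosetsP[g _ ->] /rcosetsP[h _ ->] E.
    rewrite -[LHS]rcoset_repr -[RHS]rcoset_repr; apply/rcoset_eqP.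
    by rewrite mem_rcoset StE dtree_actM [dtree_act _ p]E dtree_actK.
  move=> q; apply/mapP/orbP => [[C _ ->]|[s ->]]; first by eexists.
  exists (G :* s)%g; first by rewrite mem_enum; apply/rcosetsP; exists s.
  have : fingroup.repr (G :* s)%g \in (G :* s)%g by rewrite mem_repr_rcoset.
  by rewrite /r; case/rcosetP => g; rewrite StE => /eqP gp ->; rewrite dtree_actM gp.
rewrite -(perm_big _ r_orb) big_map big_enum; apply: eq_bigr => C _.
exact: act_deco_of.
Qed.

Lemma deco_coord_orbit_sum p q : in_basis p -> in_basis q ->
  deco_coord q (orbit_sum (deco_of p)) = (q \in orb p)%:R.
Proof.
move=> Bp Bq; rewrite orbit_sumE //.
under eq_bigr do rewrite -[deco_of _]scale1r.
rewrite (@deco_coord_sum _ (fun=> 1)) ?undup_uniq //; first by case: ifP.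
by move=> r; apply: in_basis_orb.
Qed.

(** The action permutes the terms of the sum. *)
Lemma act_orbit_sum s p : in_basis p ->
  Defs.act s (orbit_sum (deco_of p)) = orbit_sum (deco_of p).
Proof.
move=> Bp; rewrite orbit_sumE // lin_sum; last exact: act_is_linear.
under eq_bigr do rewrite act_deco_of.
by rewrite -(big_map (dtree_act s) xpredT deco_of) (perm_big _ (orb_act s p)).
Qed.

Lemma orbit_sum_orb p q : in_basis p -> q \in orb p ->
  orbit_sum (deco_of q) = orbit_sum (deco_of p).
Proof.
move=> Bp qp; rewrite !orbit_sumE //; last exact: in_basis_orb qp.
exact/perm_big/orb_eq.
Qed.

(** The witness sums the coordinates over the orbit.  Summing over the orbit
    and not over ['S_n] makes its value on the orbit exactly 1, where a sum over
    the group would give the order of the stabilizer, possibly zero in [K]. *)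
Lemma orbit_functional p : in_basis p -> exists phi : RTV V n -> K^o,
  [/\ linear phi, submod_gen (@coinv_rel K V n) `<=` [set u | phi u = 0] &
      forall q, in_basis q -> phi (deco_of q) = (q \in orb p)%:R].
Proof.
move=> Bp; pose phi u := \sum_(q <- orb p) deco_coord q u : K^o.
have phiL : linear phi.
  move=> a v w; rewrite /phi scaler_sumr -big_split.
  by apply: eq_bigr => q _; rewrite deco_coord_linear.
exists phi; split=> // [|q Bq].
  apply: submod_gen_min => [|_ [s [v ->]]] /=.
    by apply: (submodule_eq phiL) => a v w; rewrite scaler0 addr0.
  rewrite (linB _ _ phiL) /phi -[X in _ - X](perm_big _ (orb_act s^-1 p)) big_map.
  rewrite -sumrB big_seq big1 // => q qp.
  by rewrite deco_coord_act ?subrr //; apply: in_basis_orb qp.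
rewrite -deco_coord_orbit_sum // orbit_sumE //.
rewrite lin_sum; last exact: deco_coord_linear.
rewrite /phi big_seq [RHS]big_seq; apply: eq_bigr => r rp.
by have Br := in_basis_orb Bp rp; rewrite !deco_coordE // eq_sym.
Qed.

Lemma coinv_deco_neq0 p : in_basis p -> ~ submod_gen (@coinv_rel K V n) (deco_of p).
Proof.
move=> Bp; have [phi [_ phi0 phiE]] := orbit_functional Bp.
move=> /phi0 /= pp; have := phiE p Bp; rewrite pp orb_refl => /esym/eqP.
by rewrite (negPf K1).
Qed.

Lemma coinv_orb p q : in_basis p -> in_basis q ->
  submod_gen (@coinv_rel K V n) (deco_of p - deco_of q) -> q \in orb p.
Proof.
move=> Bp Bq; have [phi [phiL phi0 phiE]] := orbit_functional Bp.
move=> /phi0 /= pq; move: pq; rewrite (linB _ _ phiL) (phiE p Bp) (phiE q Bq) orb_refl.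
by case: (q \in orb p) => // /eqP; rewrite subr0 (negPf K1).
Qed.

(** Induction on a list containing the support of [u].  Invariance makes the
    coordinates of [u] equal along the orbit of [p], so one multiple of the
    orbit sum removes all of them at once. *)
Lemma invariant_gen (S : set (RTV V n)) : is_submodule S ->
  (forall p, in_basis p -> S (orbit_sum (deco_of p))) ->
  forall u, (forall s, Defs.act s u = u) -> S u.
Proof.
move=> Ssub SO u; have [s0 us0] := deco_coord_supp u.
elim: s0 u us0 => [|p s IH] u us inv.
  rewrite (_ : u = 0); first exact: (proj1 Ssub).
  by apply: deco_coord_inj => p Bp; apply/eqP; apply: contraT => /(us p Bp).
have [Bp|nBp] := pselect (in_basis p); last first.
  apply: IH => // q Bq /(us q Bq); rewrite inE => /orP[/eqP qp|//].
  by case: nBp; rewrite -qp.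
pose O := orbit_sum (deco_of p).
pose a : K := deco_coord p u.
pose u' := - a *: O + u.
have -> : u = a *: O + u' by rewrite /u' scaleNr addNKr.
apply: (proj2 Ssub); first exact: SO.
have u'E q : in_basis q -> deco_coord q u' =
    if q \in orb p then 0 else deco_coord q u.
  move=> Bq; rewrite /u' deco_coord_linear deco_coord_orbit_sum //.
  case: ifP => [/orbP[g qE]|_]; last by rewrite scaler0 add0r.
  have -> : deco_coord q u = a.
    by rewrite -(inv g) deco_coord_act // qE dtree_actK.
  by rewrite -[_ *: _]/(_ * _) mulr1 addNr.
apply: IH => [q Bq|g]; last first.
  by rewrite /u' act_is_linear act_orbit_sum // inv.
rewrite u'E //; case: ifP => [|qNp /(us q Bq)]; first by rewrite eqxx.
by rewrite inE => /orP[/eqP qp|//]; rewrite qp orb_refl in qNp.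
Qed.

End Decorated.

(** * The basis of orbit sums *)

Lemma Gamma_RT_submodule (K : comPzRingType) (V : lmodType K) :
  is_submodule (Gamma_RT V).
Proof.
split=> [n s|a u v Gu Gv n s]; first exact (lin0 (act_is_linear s)).
exact: etrans (act_is_linear s a (u n) (v n)) (f_equal2 _ (congr1 _ (Gu n s)) (Gv n s)).
Qed.

Lemma Gamma_RT_in (K : comPzRingType) (V : lmodType K) n (u : RTV V n) :
  (forall s, Defs.act s u = u) -> Gamma_RT V (dsum_in u).
Proof.
move=> inv m s; have [nm|nm] := eqVneq n m.
  by case: m / nm in s *; rewrite dsum_in_same.
rewrite (dsum_in_other _ nm); exact (lin0 (act_is_linear s)).
Qed.

Section OrbitBasis.
Variables (K : comPzRingType) (V : lmodType K) (B : set V) (coord : V -> V -> K^o).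
Hypothesis genB : submod_gen B = [set: V].
Hypothesis coordL : forall b, linear (coord b).
Hypothesis coordB : forall b b', B b -> B b' -> coord b b' = (b == b')%:R.
Hypothesis K1 : 1 != 0 :> K.

Definition dsum_orbit_sum n (p : dtree V n) : dsum (RTV V) :=
  dsum_in (orbit_sum (deco_of p)).

(** The equality of classes also forces the degrees to agree, since the class of
    a decorated tree is nonzero when [1 != 0]. *)
Lemma S_class_orbit_sum n m (p : dtree V n) (q : dtree V m) :
  in_basis B p -> in_basis B q -> S_class p.1 p.2 = S_class q.1 q.2 ->
  dsum_orbit_sum p = dsum_orbit_sum q.
Proof.
move=> Bp Bq pq.
have {pq} := congr1 (fun u : S_RT V => u n) pq; rewrite /= dfwith_in.
have [nm|mn] := eqVneq m n.
  case: n / nm in p Bp *; rewrite dfwith_in => /clsP pq; congr dsum_in.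
  apply/esym/(orbit_sum_orb coordL coordB K1 Bp).
  exact: (coinv_orb genB coordL coordB K1 Bp Bq).
rewrite dfwith_out // => p0; case: (coinv_deco_neq0 genB coordL coordB K1 Bp).
by rewrite -[deco_of p]subr0; apply/clsP.
Qed.

Lemma OO_S_class n (p : dtree V n) : in_basis B p ->
  OO B (S_class p.1 p.2) = dsum_orbit_sum p.
Proof.
move=> Bp; apply: xget_unique; first by exists n, p.1, p.2.
move=> _ [m [t [x [Bx pq ->]]]].
exact/esym/(@S_class_orbit_sum _ _ p (t, x)).
Qed.

Lemma OSE : OS B =
  [set o | exists n (p : dtree V n), in_basis B p /\ o = dsum_orbit_sum p].
Proof.
apply/seteqP; split=> [_ [_ [n [t [x [Bx ->]]]] <-]|_ [n [p [Bp ->]]]] /=.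
  by exists n, (t, x); split=> //; apply: (@OO_S_class _ (t, x)).
by exists (S_class p.1 p.2); [exists n, p.1, p.2 | apply: OO_S_class].
Qed.

(** Read on [p], an orbit sum in any degree has coordinate 1 if it is the orbit
    sum of [p], and 0 otherwise. *)
Lemma dsum_orbit_sum_coord n m (p : dtree V n) (q : dtree V m) :
  in_basis B p -> in_basis B q ->
  deco_coord coord p (dsum_orbit_sum q n) = (dsum_orbit_sum q == dsum_orbit_sum p)%:R.
Proof.
move=> Bp Bq; have [qp|qNp] := eqVneq (dsum_orbit_sum q) (dsum_orbit_sum p).
  rewrite qp [dsum_orbit_sum p n]dsum_in_same.
  by rewrite (deco_coord_orbit_sum coordL coordB K1 Bp Bp) orb_refl.
have [mn|mn] := eqVneq m n; last first.
  rewrite [dsum_orbit_sum q n](dsum_in_other _ mn).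
  exact: lin0 (deco_coord_linear coordL p).
case: n / mn in p Bp qNp *; rewrite [dsum_orbit_sum q m]dsum_in_same.
rewrite (deco_coord_orbit_sum coordL coordB K1 Bq Bp).
case: (boolP (p \in orb q)) => // /(orbit_sum_orb coordL coordB K1 Bq) pq.
by move: qNp; rewrite /dsum_orbit_sum pq eqxx.
Qed.

Lemma OS_lin_indep : lin_indep (OS B).
Proof.
apply: lin_indep_dual => o; rewrite OSE => -[n [p [Bp ->]]].
exists (fun u : dsum (RTV V) => deco_coord coord p (u n)); split.
  by move=> b u v /=; apply: deco_coord_linear.
by move=> _ [m [q [Bq ->]]]; apply: dsum_orbit_sum_coord.
Qed.

Lemma OS_gen : submod_gen (OS B) = Gamma_RT V.
Proof.
apply/seteqP; split=> [|u Gu].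
  apply: submod_gen_min; first exact: Gamma_RT_submodule.
  rewrite OSE => _ [n [p [Bp ->]]]; apply: Gamma_RT_in => s.
  exact: (act_orbit_sum coordL coordB K1 s Bp).
apply: (dsum_gen (submod_gen_closed (OS B))) => n.
apply: (invariant_gen genB coordL coordB K1 (S := @dsum_in _ _ _ n @^-1` submod_gen (OS B))).
- exact/submodule_preim/submod_gen_closed/dsum_in_linear.
- by move=> p Bp; apply: sub_submod_gen; rewrite OSE; exists n, p.
- by move=> s; apply: Gu.
Qed.

End OrbitBasis.

Theorem proposition3p16 (K : comPzRingType) (V : lmodType K) (B : set V) :
  is_basis [set: V] B -> is_basis (Gamma_RT V) (OS B).
Proof.
move=> basisB; have [coord [coordL coordB]] := coord_exists basisB.
have [K0|K1] := eqVneq (1 : K) 0; last first.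
  split; first exact: OS_lin_indep (proj2 basisB) coordL coordB K1.
  exact: OS_gen (proj2 basisB) coordL coordB K1.
have M0 (M : lmodType K) (u : M) : u = 0 by rewrite -[u]scale1r K0 scale0r.
split=> [a _ _ o _|]; first by rewrite -[a o]mul1r K0 mul0r.
have [G0 _] := submod_gen_closed (OS B).
apply/seteqP; split=> u _; last by rewrite (M0 _ u).
by move=> n s; rewrite (M0 _ (u n)) (M0 _ (Defs.act _ _)).
Qed.
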